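(* Let $X$ and $Y$ be connected CW complexes and let $p\colon Y\to X$ be a covering map. Then $$\mathrm{dcat}(X)\le (\mathrm{dcat}_1(X)+1)(\mathrm{dcat}(Y)+1)-1.$$
   Context: All spaces are connected CW complexes and maps are continuous. For a space $Z$ and an integer $n\ge 1$, let $\mathcal B_n(Z)$ be the set of probability measures on $Z$ supported on at most $n$ points, i.e. formal sums $\sum_{i=1}^n a_i z_i$ with $z_i\in Z$, $a_i\ge 0$, $\sum a_i=1$ (a point $z$ standing for the Dirac measure $\delta_z$). It carries the topology of weak convergence of measures; for metric $Z$ this is the topology of the Lévy–Prokhorov metric. For a map $f\colon E\to B$ put $E_n=\{\mu\in\mathcal B_n(E)\mid \mathrm{supp}(\mu)\subset f^{-1}(b)\text{ for some } b\in B\}$, a subspace of $\mathcal B_n(E)$, and let $f_n\colon E_n\to B$ send $\mu$ to that $b$. If $f$ is a fibration, then so is $f_n$. The distributional one-category $\mathrm{dcat}_1(X)$ is the least integer $n\ge 0$ such that $q^X_{n+1}\colon \widetilde X_{n+1}\to X$ has a section, where $q^X\colon\widetilde X\to X$ is the universal covering. The distributional category $\mathrm{dcat}(X)$ is the least integer $n\ge 0$ such that $e^X_{n+1}\colon P_0(X)_{n+1}\to X$ has a section, where $P_0(X)$ is the space of paths $\phi\colon[0,1]\to X$ with $\phi(1)=x_0$ ($x_0$ a fixed basepoint) and $e^X(\phi)=\phi(0)$. Both invariants are $\infty$ if no such $n$ exists. *)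

(* Defs.v *)
From HB Require Import structures.
From mathcomp Require Import all_boot all_order all_algebra finmap.
From mathcomp Require Import all_classical all_reals all_analysis.

Set Implicit Arguments.
Unset Strict Implicit.
Unset Printing Implicit Defensive.

Import Order.TTheory GRing.Theory Num.Theory.
Import numFieldNormedType.Exports.

Local Open Scope classical_set_scope.
Local Open Scope ring_scope.

Definition has_section (E B : topologicalType) (f : E -> B) : Prop :=
  exists2 s : B -> E, continuous s & cancel s f.

Definition homeomorphism_on (S T : topologicalType) (A : set S) (B : set T)
    (f : S -> T) : Prop :=
  {within A, continuous f} /\ f @` A `<=` B /\
  exists g : T -> S, [/\ {within B, continuous g}, g @` B `<=` A,
    {in A, cancel f g} & {in B, cancel g f}].

Section cw.
Context {R : realType}.

(* The disks are Euclidean: the norm that the library puts on ['rV_n] is the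
   sup norm, which induces the same topology.  In dimension 0 the disk is a
   point and the sphere is empty. *)
Definition sqnorm n (v : 'rV[R]_n) : R := \sum_(i < n) v ord0 i ^+ 2.
Definition disk n : set 'rV[R]_n := [set v | sqnorm v <= 1].
Definition odisk n : set 'rV[R]_n := [set v | sqnorm v < 1].
Definition sphere n : set 'rV[R]_n := [set v | sqnorm v = 1].

(* A CW structure given by its characteristic maps.  As [disk n] is closed,
   the closed subsets of the disk are the closed subsets of R^n that it
   contains. *)
Definition CW_structure (X : topologicalType) (I : Type) (dim : I -> nat)
    (Phi : forall i, 'rV[R]_(dim i) -> X) : Prop :=
  let cell i := Phi i @` odisk (n := dim i) in
  [/\ forall i, {within disk (n := dim i), continuous (Phi i)},
      forall i, homeomorphism_on (odisk (n := dim i)) (cell i) (Phi i),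
      trivIset setT cell /\ \bigcup_i cell i = setT,
      forall i, exists J : set I,
        [/\ finite_set J, (forall j, J j -> (dim j < dim i)%N) &
            Phi i @` sphere (n := dim i) `<=` \bigcup_(j in J) cell j] &
      forall A : set X, closed A <->
        forall i, closed (disk (n := dim i) `&` Phi i @^-1` A)].

End cw.

Definition CW_complex (R : realType) (X : topologicalType) : Prop :=
  hausdorff_space X /\
  exists (I : Type) (dim : I -> nat) (Phi : forall i, 'rV[R]_(dim i) -> X),
    CW_structure Phi.

Definition covering_map (Y X : topologicalType) (p : Y -> X) : Prop :=
  continuous p /\
  forall x : X, exists U : set X, [/\ open U, U x &
    exists (I : Type) (V : I -> set Y),
      [/\ forall i, open (V i), trivIset setT V,
          p @^-1` U = \bigcup_i V i &
          forall i, homeomorphism_on (V i) U p]].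

Section paths.
Context {R : realType}.

Definition unitI : Type := `[0 : R, 1]%classic.

Lemma unitI0_subproof : (0 : R) \in `[0 : R, 1]%classic.
Proof. by rewrite inE /= in_itv /= lexx ler01. Qed.
Lemma unitI1_subproof : (1 : R) \in `[0 : R, 1]%classic.
Proof. by rewrite inE /= in_itv /= lexx ler01. Qed.

Definition I0 : unitI := exist _ 0 unitI0_subproof.
Definition I1 : unitI := exist _ 1 unitI1_subproof.

End paths.
Arguments unitI : clear implicits.

Definition path_connected (R : realType) (T : topologicalType) : Prop :=
  forall x y : T, exists2 g : unitI R -> T,
    continuous g & g I0 = x /\ g I1 = y.

Definition simply_connected (R : realType) (T : topologicalType) : Prop :=
  [/\ inhabited T, path_connected R T &
    forall g : unitI R -> T, continuous g -> g I0 = g I1 ->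
      exists2 H : unitI R * unitI R -> T, continuous H &
        [/\ forall s, H (s, I0) = g s,
            forall s, H (s, I1) = g I0,
            forall t, H (I0, t) = g I0 &
            forall t, H (I1, t) = g I0]].

Definition universal_covering (R : realType) (Xt X : topologicalType)
    (q : Xt -> X) : Prop :=
  covering_map q /\ simply_connected R Xt.

Definition based_paths (R : realType) (X : topologicalType) (x0 : X) :
    set {compact-open, unitI R -> X} :=
  [set phi | continuous (phi : unitI R -> X) /\ phi I1 = x0].

Arguments based_paths R {X} x0.

Definition path_start (R : realType) (X : topologicalType) (x0 : X)
    (phi : based_paths R x0) : X := (set_val phi : unitI R -> X) I0.

Section fprob.
Context {R : realType} (Z : topologicalType).

(* The formal sum [\sum_i a_i z_i], like terms collected, is the finitely
   supported function sending [z] to the mass of the point [z]. *)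
Definition fprob_set (n : nat) : set {fsfun Z -> R with 0} :=
  [set mu : {fsfun Z -> R with 0} |
    [/\ forall z, 0 <= mu z, \sum_(z <- finsupp mu) mu z = 1 &
        (#|` finsupp mu| <= n)%N]].

Definition fintegral (mu : {fsfun Z -> R with 0}) (g : Z -> R) : R :=
  \sum_(z <- finsupp mu) mu z * g z.

Definition test_functions : set (Z -> R) :=
  [set g | continuous g /\ exists M : R, forall z, `|g z| <= M].

Definition fprob_eval n (mu : fprob_set n) : {ptws test_functions -> R} :=
  fun g => fintegral (val mu) (val g).

(* B_n(Z) with the topology of weak convergence, i.e. the coarsest one making
   all integrals of bounded continuous functions continuous. *)
Definition fprob (n : nat) : Type := initial_topology (@fprob_eval n).
HB.instance Definition _ n := Topological.copy (fprob n)
  (initial_topology (@fprob_eval n)).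

Definition fsupp n (mu : fprob n) : set Z :=
  [set` finsupp (val (mu : fprob_set n))].

End fprob.
Arguments fprob : clear implicits.

Section fibrewise.
Context {R : realType} (E B : topologicalType) (f : E -> B) (n : nat).

Definition fibrewise_fprob : set (fprob R E n) :=
  [set mu | exists b : B, fsupp mu `<=` f @^-1` [set b]].

(* The point [b] is unique because the support of [mu] is nonempty. *)
Definition fibrewise_map (mu : fibrewise_fprob) : B :=
  sval (cid (set_mem (valP mu))).

End fibrewise.
Arguments fibrewise_map R {E B} f n mu.

(* [ereal_inf set0 = +oo]: the value is infinite if no section exists. *)
Definition least_section (R : realType) (E B : topologicalType) (f : E -> B) :
    \bar R :=
  ereal_inf [set (n%:R)%:E | n in
    [set n : nat | has_section (fibrewise_map R f n.+1)]].

(* An invariant of [X] only: the universal covering [q] is unique up to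
   isomorphism over [X]. *)
Definition dcat1 (R : realType) (Xt X : topologicalType) (q : Xt -> X) :
    \bar R := least_section R q.

Definition dcat (R : realType) (X : topologicalType) (x0 : X) : \bar R :=
  least_section R (@path_start R X x0).

(* Main.v *)
Require Import Defs.
From HB Require Import structures.
From mathcomp Require Import all_boot all_order all_algebra finmap.
From mathcomp Require Import all_classical all_reals all_analysis.
From mathcomp Require Import ring lra.
Import Order.TTheory GRing.Theory Num.Theory.
Import numFieldNormedType.Exports.
Local Open Scope classical_set_scope.
Local Open Scope ring_scope.

(** Since [Xt] is simply connected and locally path connected, [q] lifts to a
    map [f : Xt -> Y] over [X].  Fix a path from [p y0] to [x0].  A path in [Y]
    from [y] to [y0], mapped by [p] and followed by that path, is a path from
    [p y] to [x0], so a section of the measures on based paths of [Y] gives a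
    kernel [K] sending [z : Xt] to a measure with at most [m + 1] atoms on the
    based paths of [X] starting at [q z].  Averaging [K] against the measures
    [s x] given by a section for [q] yields a section for [X] with at most
    [(n + 1) (m + 1)] atoms.  It is weakly continuous because the integral of
    [g] against the average is the integral over [s x] of the bounded
    continuous function [z |-> \int g d(K z)]. *)

Set Implicit Arguments.
Unset Strict Implicit.

(** * Topology and coverings *)

Lemma continuous_into_initial (S : choiceType) (T U : topologicalType)
    (f : S -> T) (g : U -> initial_topology f) :
  continuous (f \o g : U -> T) -> continuous g.
Proof.
move=> /continuousP fg; apply/continuousP => A [B oB <-].
exact: fg.
Qed.

Lemma within_continuous_comp_sub (U V W : topologicalType) (A : set U)
    (B : set V) (f : V -> W) (g : U -> V) :
  {within A, continuous g} -> g @` A `<=` B -> {within B, continuous f} ->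
  {within A, continuous (f \o g)}.
Proof.
move=> /subspace_continuousP cg gAB /subspace_continuousP cf.
apply/subspace_continuousP => x Ax.
have Bgx : B (g x) by apply: gAB; exists x.
apply: cvg_trans (cf _ Bgx).
move=> N /= /(cg _ Ax); rewrite !nbhs_simpl /within /= => H.
near=> a => Aa; apply: (near H a) => //.
by apply: gAB; exists a.
Unshelve. all: by end_near. Qed.

(** Evenly covered neighbourhoods in the form used below: [V] is the sheet through [y], and [s] is
    the inverse of [p] on it. [s] is total, with arbitrary values outside [U], and one [U] serves
    all [y] above it. *)
Lemma covering_sheets (Y X : topologicalType) (p : Y -> X) (x : X) :
  covering_map p -> exists2 U : set X, open U /\ U x &
  forall y, U (p y) -> exists (V : set Y) (s : X -> Y),
    [/\ open V, V y, forall y', V y' -> s (p y') = y',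
        forall x', U x' -> p (s x') = x' &
        forall x', U x' -> {for x', continuous s}].
Proof.
move=> [_ /(_ x)] [U [oU Ux [I [V [oV _ pU hV]]]]].
exists U => // y Uy.
have [i _ Viy] : (\bigcup_i V i) y by rewrite -pU.
have [_ [_ [g [cg gV pg gp]]]] := hV i.
exists (V i), g; split => //.
- by move=> y' Vy'; apply: pg; rewrite inE.
- by move=> x' Ux'; apply: gp; rewrite inE.
- move=> x' Ux'; move: cg; rewrite continuous_open_subspace// => /(_ x').
  by apply; rewrite inE.
Qed.

(** [p] is injective on each sheet, so distinct points of a fibre lie in different, hence disjoint,
    sheets. *)
Lemma covering_separates (Y X : topologicalType) (p : Y -> X) (y1 y2 : Y) :
  covering_map p -> p y1 = p y2 -> y1 <> y2 ->
  exists V1 V2 : set Y, [/\ open_nbhs y1 V1, open_nbhs y2 V2 &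
    V1 `&` V2 = set0].
Proof.
move=> [_ /(_ (p y1))] [U [oU Ux [I [V [oV tV pU hV]]]]] y12 ny12.
have [i _ Vi] : (\bigcup_i V i) y1 by rewrite -pU.
have [j _ Vj] : (\bigcup_i V i) y2 by rewrite -pU /= -y12.
exists (V i), (V j); split => //.
apply/eqP; rewrite -(negbK (_ == _)); apply/negP => /set0P Vij.
have ij := tV i j Logic.I Logic.I Vij; subst j.
have [_ [_ [g [_ _ pg _]]]] := hV i.
by apply: ny12; rewrite -(pg y1) ?inE// -(pg y2) ?inE// y12.
Qed.

(** The set where the lifts agree is clopen in [A]: open because [p] is injective on sheets, closed
    because distinct points of a fibre can be separated. *)
Lemma lift_unique (Y X T : topologicalType) (p : Y -> X) (A : set T)
    (f g : T -> Y) (a : T) :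
  covering_map p -> connected A ->
  {within A, continuous f} -> {within A, continuous g} ->
  (forall t, A t -> p (f t) = p (g t)) ->
  A a -> f a = g a -> forall t, A t -> f t = g t.
Proof.
move=> pcov /clopen_connectedP cA cf cg fg Aa fga.
pose B := [set t | A t /\ f t = g t].
suff BA : B = A by move=> t; rewrite -BA => -[].
apply: cA; last 2 first.
- by move=> t [].
- by exists a.
split.
  rewrite openE => t [At ft]; rewrite /interior.
  have [U [oU Ut] /(_ (f t))] := covering_sheets (p (f t)) pcov.
  move=> /(_ Ut) [V [s [oV Vt sV _ _]]].
  have Nf : nbhs (t : subspace A) (f @^-1` V).
    by apply: cf; exact: open_nbhs_nbhs.
  have Ng : nbhs (t : subspace A) (g @^-1` V).
    by apply: cg; rewrite /from_subspace -ft; exact: open_nbhs_nbhs.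
  have NA : nbhs (t : subspace A) A.
    by apply: open_nbhs_nbhs; split => //; exact: open_subspaceT.
  apply: filterS3 NA Nf Ng => u Au Vf Vg; split => //.
  by rewrite -(sV _ Vf) fg// sV.
rewrite -openC openE => t nBt; rewrite /interior.
(* Points outside [A] are isolated in [subspace A]. *)
have [At|nAt] := pselect (A t); last first.
  have : open ([set t] : set (subspace A)) by exact: open_subspace1out.
  move=> o; apply: filterS (open_nbhs_nbhs (conj o erefl)) => u -> [].
  by move=> /nAt.
have nfg : f t <> g t by move=> e; apply: nBt.
have [V1 [V2 [V1t V2t V12]]] := covering_separates pcov (fg _ At) nfg.
have Nf : nbhs (t : subspace A) (f @^-1` V1).
  by apply: cf; exact: open_nbhs_nbhs.
have Ng : nbhs (t : subspace A) (g @^-1` V2).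
  by apply: cg; exact: open_nbhs_nbhs.
apply: filterS2 Nf Ng => u Vf Vg [_ fgu].
have : (V1 `&` V2) (f u) by split => //; rewrite fgu.
by rewrite V12.
Qed.

(** A supremum argument that stands in for subdivision by a Lebesgue number. *)
Lemma segment_induction (R : realType) (P : R -> R -> Prop) :
  (forall a b c, a <= b -> b <= c -> P a b -> P b c -> P a c) ->
  (forall x, exists2 e, 0 < e &
     forall a b, x - e < a -> a <= b -> b < x + e -> P a b) ->
  forall a b, a <= b -> P a b.
Proof.
move=> Padd Ploc a b ab.
pose S := [set t | a <= t <= b /\ P a t].
have Sa : S a.
  split; first by rewrite lexx.
  have [e e0 He] := Ploc a; apply: He => //.
    by rewrite ltrBlDr ltrDl.
  by rewrite ltrDl.
have supS : has_sup S.
  by split; [exists a|exists b => t [/andP[]]].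
set c := sup S.
have ac : a <= c by apply: ub_le_sup => //; case: supS.
have cb : c <= b by apply: ge_sup => //; [exists a|move=> t [/andP[]]].
have [e e0 He] := Ploc c.
have [t [/andP[at_ tb] Pat] ct] := sup_adherent e0 supS.
have tc : t <= c by apply: ub_le_sup => //; [case: supS|split => //; apply/andP].
(* [u] lies beyond the supremum [c] unless it equals [b]; as it is again in [S], it must be [b]. *)
pose u := Num.min b (c + e / 2).
have tu : t <= u.
  by rewrite le_min tb /= (le_trans tc)// lerDl divr_ge0// ltW.
have Pau : P a u.
  apply: (Padd a t) => //; apply: He => //.
  by rewrite gt_min ltrD2l ltr_pdivrMr// ltr_pMr// ltr1n orbT.
have Su : S u.
  by split => //; rewrite (le_trans at_)//= ge_min lexx.
have uc : u <= c by apply: ub_le_sup => //; case: supS.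
suff <- : u = b by [].
move: uc; rewrite /u; case: (leP b (c + e / 2)) => // _.
by rewrite gerDl leNgt divr_gt0.
Qed.

(** Retraction of the line onto [0, 1]; it turns paths and squares into total functions on [R] and
    [R * R]. *)
Definition clamp {R : realType} (r : R) : R := Num.max 0 (Num.min 1 r).

Lemma clamp_itv (R : realType) (r : R) : 0 <= clamp r <= 1.
Proof. by rewrite /clamp le_max lexx /= ge_max ler01 ge_min lexx. Qed.

Lemma clamp_id (R : realType) (r : R) : 0 <= r <= 1 -> clamp r = r.
Proof. by move=> /andP[r0 r1]; rewrite /clamp min_r// max_r. Qed.

Lemma continuous_clamp (R : realType) : continuous (@clamp R).
Proof.
move=> r; apply: continuous_max; first exact: cvg_cst.
by apply: continuous_min; [exact: cvg_cst|exact: cvg_id].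
Qed.

Lemma clamp_unitI_subproof (R : realType) (r : R) :
  clamp r \in `[0 : R, 1]%classic.
Proof. by rewrite inE /= in_itv /= clamp_itv. Qed.

Definition clampI {R : realType} (r : R) : unitI R :=
  exist _ (clamp r) (clamp_unitI_subproof r).

Lemma continuous_clampI (R : realType) : continuous (@clampI R).
Proof.
apply: (continuous_into_initial (f := (set_val : unitI R -> R))).
exact: continuous_clamp.
Qed.

Lemma clampI0 (R : realType) : clampI (0 : R) = I0.
Proof. by apply: val_inj; rewrite /= clamp_id// lexx ler01. Qed.

Lemma clampI1 (R : realType) : clampI (1 : R) = I1.
Proof. by apply: val_inj; rewrite /= clamp_id// lexx ler01. Qed.

Lemma continuous_pair (S T U : topologicalType) (f : S -> T) (g : S -> U) :
  continuous f -> continuous g -> continuous (fun s => (f s, g s)).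
Proof.
by move=> cf cg s; apply: (@cvg_pair _ _ _ _ (nbhs (f s)) (nbhs (g s)));
  [exact: cf|exact: cg].
Qed.

Lemma continuous_pairl (T U : topologicalType) (a : T) :
  continuous (fun u : U => (a, u)).
Proof. by apply: continuous_pair => u; [exact: cvg_cst|exact: cvg_id]. Qed.

Lemma continuous_pairr (T U : topologicalType) (a : T) :
  continuous (fun u : U => (u, a)).
Proof. by apply: continuous_pair => u; [exact: cvg_id|exact: cvg_cst]. Qed.

(** * Lifting squares and paths through a covering *)

(** The prescribed point [a] may be anywhere in [Q], so that a union can be lifted starting from
    either piece. *)
Definition lifts_over (Y X T : topologicalType) (p : Y -> X) (h : T -> X)
    (Q : set T) : Prop :=
  forall a y, Q a -> p y = h a ->
  exists f : T -> Y, [/\ {within Q, continuous f},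
    forall t, Q t -> p (f t) = h t & f a = y].

(** Lift over the piece containing the prescribed point, then over the other piece through the value
    at a common point. The lifts agree on the connected intersection by uniqueness, and glue because
    the pieces are closed. *)
Lemma lifts_overU (Y X T : topologicalType) (p : Y -> X) (h : T -> X)
    (A B : set T) :
  covering_map p -> closed A -> closed B -> connected (A `&` B) ->
  A `&` B !=set0 -> lifts_over p h A -> lifts_over p h B ->
  lifts_over p h (A `|` B).
Proof.
move=> pcov.
have half (A' B' : set T) a y : closed A' -> closed B' ->
    connected (A' `&` B') -> A' `&` B' !=set0 ->
    lifts_over p h A' -> lifts_over p h B' -> A' a -> p y = h a ->
    exists f : T -> Y, [/\ {within A' `|` B', continuous f},
      forall t, (A' `|` B') t -> p (f t) = h t & f a = y].
  move=> cA cB cAB [b [Ab Bb]] lA lB Aa ya.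
  have [f [cf pf fa]] := lA a y Aa ya.
  have [g [cg pg gb]] := lB b (f b) Bb (pf _ Ab).
  have fg : forall t, (A' `&` B') t -> f t = g t.
    apply: (@lift_unique _ _ _ p _ f g b) => //.
    - by apply: continuous_subspaceW cf => t [].
    - by apply: continuous_subspaceW cg => t [].
    - by move=> t [At Bt]; rewrite pf// pg.
  pose k t := if t \in A' then f t else g t.
  have kA t : A' t -> k t = f t by move=> At; rewrite /k mem_set.
  have kB t : B' t -> k t = g t.
    by move=> Bt; rewrite /k; case: ifP => // /set_mem At; rewrite fg.
  exists k; split.
  - apply: withinU_continuous => //.
    + by apply: subspace_eq_continuous cf => t; rewrite inE => /kA.
    + by apply: subspace_eq_continuous cg => t; rewrite inE => /kB.
  - by move=> t [/[dup] At /kA ->|/[dup] Bt /kB ->]; [exact: pf|exact: pg].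
  - by rewrite kA.
move=> cA cB cAB nAB lA lB a y [Aa|Ba] ya; first exact: half.
by rewrite setUC; apply: half => //; rewrite setIC.
Qed.

Lemma lifts_over_near (Y X T : topologicalType) (p : Y -> X) (h : T -> X)
    (t : T) :
  covering_map p -> continuous h ->
  exists2 N, nbhs t N & forall Q, Q `<=` N -> lifts_over p h Q.
Proof.
move=> pcov ch.
have [U [oU Ut] Us] := covering_sheets (h t) pcov.
exists (h @^-1` U); first by apply: ch; exact: open_nbhs_nbhs.
move=> Q QN a y Qa ya.
have [|V [s [oV Vy sp ps cs]]] := Us y; first by rewrite ya; exact: QN.
exists (s \o h); split.
- apply: continuous_in_subspaceT => u; rewrite inE => Qu.
  by apply: continuous_comp; [exact: ch|apply: cs; exact: QN].
- by move=> u Qu; apply: ps; exact: QN.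
- by rewrite /= -ya sp.
Qed.

Definition rect (R : realType) (a b c d : R) : set (R * R) :=
  `[a, b]%classic `*` `[c, d]%classic.

Lemma closed_rect (R : realType) (a b c d : R) : closed (rect a b c d).
Proof.
have -> : rect a b c d =
    (fst @^-1` `[a, b]%classic) `&` (snd @^-1` `[c, d]%classic) by [].
by apply: closedI; apply: closed_comp; (try by exact: interval_closed) => z _;
  [exact: cvg_fst|exact: cvg_snd].
Qed.

Lemma rect_catl (R : realType) (a b c d e : R) : a <= b -> b <= c ->
  rect a c d e = rect a b d e `|` rect b c d e.
Proof.
move=> ab bc; apply/seteqP; split => [[x y]|[x y]] /=;
  rewrite /rect /= !in_itv /=.
  move=> [/andP[ax xc] ->]; case: (leP x b) => xb; [left|right]; split => //.
    by rewrite ax.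
  by rewrite ltW.
by move=> [[/andP[ax xb] ->]|[/andP[bx xc] ->]]; split => //;
  rewrite ?ax ?xc ?andbT/=;
  [exact: le_trans xb bc|exact: le_trans ab bx].
Qed.

Lemma rect_catr (R : realType) (a b c d e : R) : a <= b -> b <= c ->
  rect d e a c = rect d e a b `|` rect d e b c.
Proof.
move=> ab bc; have := rect_catl d e ab bc => E.
apply/seteqP; split => [[y x]|[y x]] /=.
  move=> [dye axc]; have : rect a c d e (x, y) by [].
  by rewrite E => -[[]|[]]; [left|right].
move=> H; suff [xa yd] : rect a c d e (x, y) by split.
by rewrite E; case: H => -[]; [left|right].
Qed.

(** Two nested interval inductions, one per coordinate; adjacent rectangles meet in a segment, which
    is connected. *)
Lemma lifts_over_rect (R : realType) (Y X : topologicalType) (p : Y -> X)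
    (h : R * R -> X) : covering_map p -> continuous h ->
  forall a b c d, a <= b -> c <= d -> lifts_over p h (rect a b c d).
Proof.
move=> pcov ch a b c d ab cd.
move: a b ab; apply: (segment_induction
  (P := fun a b => lifts_over p h (rect a b c d))).
  move=> a b e ab be la lb; rewrite (rect_catl _ _ ab be).
  apply: lifts_overU => //; try exact: closed_rect.
    have -> : rect a b c d `&` rect b e c d = (pair b) @` `[c, d]%classic.
      apply/seteqP; split => [[x y]|[x y]]; rewrite /rect /= !in_itv /=.
        move=> [[/andP[_ xb] H] [/andP[bx _] _]]; exists y => //.
        by congr pair; apply/le_anti; rewrite bx xb.
      by move=> [z H [<- <-]]; move: H; rewrite in_itv/= => ->;
        rewrite ab be !lexx.
    apply: connected_continuous_connected; first exact: segment_connected.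
    by apply: continuous_subspaceT; exact: continuous_pairl.
  by exists (b, c); rewrite /rect /= !in_itv /= !lexx ab be cd.
move=> x; move: c d cd.
(* The inner induction keeps a strip around [x] whose width may depend on [c] and [d]; two strips
   combine by taking the smaller width. *)
pose P c d := exists2 e, 0 < e & forall a b, x - e < a -> a <= b ->
  b < x + e -> lifts_over p h (rect a b c d).
apply: (@segment_induction _ P).
  move=> c d f cd df [e1 e10 H1] [e2 e20 H2].
  exists (Num.min e1 e2); first by rewrite lt_min e10.
  move=> a b xa ab bx; rewrite (rect_catr _ _ cd df).
  have [l1 l2] : lifts_over p h (rect a b c d) /\ lifts_over p h (rect a b d f).
    split; [apply: H1|apply: H2] => //.
    - by apply: le_lt_trans xa; rewrite lerD2l lerN2 ge_min lexx.
    - by apply: lt_le_trans bx _; rewrite lerD2l ge_min lexx.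
    - by apply: le_lt_trans xa; rewrite lerD2l lerN2 ge_min lexx orbT.
    - by apply: lt_le_trans bx _; rewrite lerD2l ge_min lexx orbT.
  apply: lifts_overU => //; try exact: closed_rect.
    have -> : rect a b c d `&` rect a b d f =
        (fun z => (z, d)) @` `[a, b]%classic.
      apply/seteqP; split => [[u y]|[u y]]; rewrite /rect /= !in_itv /=.
        move=> [[H /andP[_ xb]] [_ /andP[bx' _]]]; exists u => //.
        by congr pair; apply/le_anti; rewrite bx' xb.
      by move=> [z H [<- <-]]; move: H; rewrite in_itv/= => ->;
        rewrite cd df !lexx.
    apply: connected_continuous_connected; first exact: segment_connected.
    by apply: continuous_subspaceT; exact: continuous_pairr.
  by exists (a, d); rewrite /rect /= !in_itv /= !lexx ab cd df.
move=> t.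
have [N + HN] := lifts_over_near (x, t) pcov ch.
rewrite -nbhs_ballE => -[e e0 eN]; exists e => // c d tc cd dt.
exists e => // a b xa ab bx; apply: HN => -[u v].
rewrite /rect /= !in_itv /= => -[/andP[au ub] /andP[cv vd]].
apply: eN; split; rewrite /ball /= ltr_distlC.
  by rewrite (lt_le_trans xa au) (le_lt_trans ub bx).
by rewrite (lt_le_trans tc cv) (le_lt_trans vd dt).
Qed.

Lemma square_lift (R : realType) (Y X : topologicalType) (p : Y -> X)
    (h : R * R -> X) (y : Y) : covering_map p -> continuous h ->
  p y = h (0, 0) ->
  exists f : R * R -> Y, [/\ continuous f, f (0, 0) = y &
    forall s t, p (f (s, t)) = h (clamp s, clamp t)].
Proof.
move=> pcov ch y0.
have H0 : rect 0 1 0 1 (0 : R, 0 : R).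
  by rewrite /rect /= !in_itv /= lexx ler01.
have [f [cf pf f0]] := lifts_over_rect pcov ch ler01 ler01 H0 y0.
pose cl (z : R * R) := (clamp z.1, clamp z.2).
have clr z : rect 0 1 0 1 (cl z) by rewrite /rect /= !in_itv /= !clamp_itv.
have ccl : continuous cl.
  apply: continuous_pair => z.
    by apply: (@continuous_comp _ _ _ fst clamp);
      [exact: cvg_fst|exact: continuous_clamp].
  by apply: (@continuous_comp _ _ _ snd clamp);
    [exact: cvg_snd|exact: continuous_clamp].
exists (f \o cl); split.
- apply/continuous_subspace_setT.
  apply: within_continuous_comp_sub cf; first exact: continuous_subspaceT.
  by move=> _ [z _ <-].
- by rewrite /= /cl /= clamp_id// lexx ler01.
- by move=> s t; rewrite /= pf.
Qed.

Lemma path_lift (R : realType) (Y X : topologicalType) (p : Y -> X)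
    (g : R -> X) (y : Y) : covering_map p -> continuous g -> p y = g 0 ->
  exists f : R -> Y, [/\ continuous f, f 0 = y &
    forall s, p (f s) = g (clamp s)].
Proof.
move=> pcov cg y0.
(* A path is lifted as a square that is constant in the second variable. *)
have ch : continuous (g \o fst : R * R -> X).
  by move=> z; apply: continuous_comp; [exact: cvg_fst|exact: cg].
have [f [cf f0 pf]] := square_lift pcov ch y0.
exists (fun s => f (s, 0)); split => //.
move=> s; apply: (@continuous_comp _ _ _ (fun s => (s, 0 : R)) f); last exact: cf.
exact: continuous_pairr.
Qed.

(** * Local path connectedness *)

Definition joined (R : realType) (T : topologicalType) (A : set T) (x y : T) :=
  exists g : R -> T, [/\ continuous g, forall t, A (g t), g 0 = x & g 1 = y].

Lemma joined_refl (R : realType) (T : topologicalType) (A : set T) (x : T) :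
  A x -> joined R A x x.
Proof. by move=> Ax; exists (fun=> x); split => // t; exact: cvg_cst. Qed.

Lemma joined_sym (R : realType) (T : topologicalType) (A : set T) (x y : T) :
  joined R A x y -> joined R A y x.
Proof.
move=> [g [cg Ag g0 g1]]; exists (fun t => g (1 - t)); split => //.
- move=> t; apply: (@continuous_comp R R T (fun t => 1 - t) g); last exact: cg.
  by apply: cvgB; [exact: cvg_cst|exact: cvg_id].
- by rewrite subr0.
- by rewrite subrr.
Qed.

Definition path_cat (R : realType) (T : Type) (f g : R -> T) (t : R) : T :=
  if t <= 2^-1 then f (2 * t) else g (2 * t - 1).

Lemma path_cat0 (R : realType) (T : Type) (f g : R -> T) :
  path_cat f g 0 = f 0.
Proof. by rewrite /path_cat invr_ge0 ler0n mulr0. Qed.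

Lemma path_cat1 (R : realType) (T : Type) (f g : R -> T) :
  path_cat f g 1 = g 1.
Proof.
rewrite /path_cat ifF; first by congr g; ring.
by apply/negbTE; rewrite -ltNge; lra.
Qed.

Lemma path_cat_left (R : realType) (T : Type) (f g : R -> T) (t : R) :
  t <= 2^-1 -> path_cat f g t = f (2 * t).
Proof. by rewrite /path_cat => ->. Qed.

Lemma path_cat_right (R : realType) (T : Type) (f g : R -> T) (t : R) :
  f 1 = g 0 -> 2^-1 <= t -> path_cat f g t = g (2 * t - 1).
Proof.
move=> fg t2; rewrite /path_cat; case: ifPn => // t2'.
have -> : t = 2^-1 by apply/le_anti; rewrite t2 t2'.
by rewrite mulfV ?pnatr_eq0// subrr.
Qed.

Lemma continuous_path_cat (R : realType) (T : topologicalType) (f g : R -> T) :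
  continuous f -> continuous g -> f 1 = g 0 -> continuous (path_cat f g).
Proof.
move=> cf cg fg; apply/continuous_subspace_setT.
have -> : [set: R] = [set t | t <= 2^-1] `|` [set t | 2^-1 <= t].
  by apply/seteqP; split => // t _ /=;
    case: (leP t 2^-1) => [|/ltW]; [left|right].
apply: withinU_continuous; [exact: closed_le|exact: closed_ge| |].
  have cl : {within [set t | t <= 2^-1], continuous (fun t => f (2 * t))}.
    apply: continuous_subspaceT => t.
    apply: (@continuous_comp R R T (fun t => 2 * t) f); last exact: cf.
    by apply: cvgM; [exact: cvg_cst|exact: cvg_id].
  apply: subspace_eq_continuous cl => t.
  by rewrite inE /= => t2; rewrite /from_subspace path_cat_left.
have cr : {within [set t | 2^-1 <= t], continuous (fun t => g (2 * t - 1))}.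
  apply: continuous_subspaceT => t.
  apply: (@continuous_comp R R T (fun t => 2 * t - 1) g); last exact: cg.
  apply: cvgB; last exact: cvg_cst.
  by apply: cvgM; [exact: cvg_cst|exact: cvg_id].
apply: subspace_eq_continuous cr => t.
by rewrite inE /= => t2; rewrite /from_subspace path_cat_right.
Qed.

Lemma joined_trans (R : realType) (T : topologicalType) (A : set T)
    (x y z : T) : joined R A x y -> joined R A y z -> joined R A x z.
Proof.
move=> [f [cf Af f0 f1]] [g [cg Ag g0 g1]].
exists (path_cat f g); split.
- by apply: continuous_path_cat => //; rewrite f1.
- by move=> t; rewrite /path_cat; case: ifP.
- by rewrite path_cat0.
- by rewrite path_cat1.
Qed.

Definition locally_path_connected (R : realType) (T : topologicalType) :=
  forall (U : set T) x, open U -> U x -> open (joined R U x).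

(** The square function is convex in each coordinate, with defect t (1 - t) (b - a)^2. *)
Lemma disk_convex (R : realType) n (v w : 'rV[R]_n) (t : R) :
  0 <= t <= 1 -> disk v -> disk w -> disk (v + t *: (w - v)).
Proof.
move=> /andP[t0 t1]; rewrite /disk /= /sqnorm => dv dw.
apply: (@le_trans _ _ (\sum_(i < n) ((1 - t) * v ord0 i ^+ 2 +
                                      t * w ord0 i ^+ 2))).
  apply: ler_sum => i _; rewrite !mxE -subr_ge0.
  set a := v ord0 i; set b := w ord0 i.
  have -> : (1 - t) * a ^+ 2 + t * b ^+ 2 - (a + t * (b - a)) ^+ 2 =
    t * (1 - t) * (b - a) ^+ 2 by ring.
  by rewrite mulr_ge0 ?sqr_ge0// mulr_ge0// subr_ge0.
rewrite big_split /= -!mulr_sumr.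
nra.
Qed.

(* By convexity, the trace on a disk of a small ball centred at a preimage of a
   path component of [U] lies in the preimage of that component. *)
Lemma CW_locally_path_connected (R : realType) (X : topologicalType) :
  CW_complex R X -> locally_path_connected R X.
Proof.
move=> [_ [I [dim [Phi [cPhi _ _ _ Xclosed]]]]] U x oU Ux.
(* The weak topology clause, applied to the whole space, shows that the disks are closed. *)
have cdisk i : closed (disk (R := R) (n := dim i)).
  have /(Xclosed setT).1 := @closedT X.
  by move=> /(_ i); rewrite preimage_setT setIT.
(* The complement of the component has to pull back to a closed subset of each disk. For a limit
   point [v] of this pullback, it must be refuted that [Phi i v] is in the component. *)
rewrite -closedC; apply/(Xclosed _).2 => i v vcl.
have dv : disk v.
  by apply: cdisk; apply: closure_subset vcl => w [].
split => //= xv.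
have Uv : U (Phi i v) by have [g [_ Ug _ <-]] := xv.
have /subspace_continuousP/(_ v dv)/(_ U) := cPhi i.
move=> /(_ (open_nbhs_nbhs (conj oU Uv))); rewrite !nbhs_simpl /within /=.
rewrite -nbhs_ballE => -[e e0 eN].
have [w [[dw nxw] vw]] := vcl _ (nbhsx_ballx v e e0).
apply: nxw; apply: joined_trans xv _.
(* The segment from [v] to [w] stays in the disk and in the ball, so its image joins the two images
   inside [U]. *)
pose s (t : R) := v + clamp t *: (w - v).
have sd t : disk (s t) by apply: disk_convex => //; exact: clamp_itv.
have sU t : U (Phi i (s t)).
  apply: eN => //.
  move: vw; rewrite -!ball_normE /= /s opprD addrA subrr sub0r normrN.
  apply: le_lt_trans; rewrite normrZ distrC ler_piMl//.
  by have /andP[c0 c1] := clamp_itv t; rewrite ger0_norm.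
exists (Phi i \o s); split => //.
- apply/continuous_subspace_setT.
  apply: (within_continuous_comp_sub _ _ (cPhi i)).
    apply: continuous_subspaceT => t.
    apply: cvgD; first exact: cvg_cst.
    by apply: cvgZr_tmp; exact: continuous_clamp.
  by move=> _ [t _ <-].
- by rewrite /= /s clamp_id ?lexx ?ler01// scale0r addr0.
- by rewrite /= /s clamp_id ?lexx ?ler01// scale1r addrC subrK.
Qed.

(** The local inverse [s] carries short paths of [X] to paths inside [U]. *)
Lemma covering_locally_path_connected (R : realType) (Y X : topologicalType)
    (p : Y -> X) : covering_map p -> locally_path_connected R X ->
  locally_path_connected R Y.
Proof.
move=> pcov lX U y oU Uy; rewrite openE => z yz; rewrite /interior.
have [D [oD Dz] Ds] := covering_sheets (p z) pcov.
have [V [s [oV Vz sp ps cs]]] := Ds z Dz.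
have Uz : U z by have [g [_ Ug _ <-]] := yz.
have oDU : open (D `&` s @^-1` U).
  rewrite openE => x [Dx Ux]; apply: filterI; first exact: open_nbhs_nbhs.
  by apply: (cs x Dx); exact: open_nbhs_nbhs.
have DUz : (D `&` s @^-1` U) (p z) by split => //=; rewrite sp.
have [cp _] := pcov.
have Np : nbhs z (p @^-1` joined R (D `&` s @^-1` U) (p z)).
  apply: cp; apply: open_nbhs_nbhs; split; first exact: lX.
  exact: joined_refl.
apply: filterS2 Np (open_nbhs_nbhs (conj oV Vz)) => w [g [cg Dg g0 g1]] Vw.
apply: joined_trans yz _; exists (s \o g); split.
- move=> t; apply: continuous_comp; first exact: cg.
  by apply: cs; have [] := Dg t.
- by move=> t; have [] := Dg t.
- by rewrite /= g0 sp.
- by rewrite /= g1 sp.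
Qed.

(** * The lifting criterion *)

(* The graph of the lift is the path component of [(t0, y0)] in the fibre
   product of [h] and [p]; a loop in the fibre product closes up in [Y] because
   its null-homotopy in [T] lifts. *)
Lemma simply_connected_lift (R : realType) (T X Y : topologicalType)
    (p : Y -> X) (h : T -> X) (t0 : T) (y0 : Y) :
  covering_map p -> continuous h -> simply_connected R T ->
  locally_path_connected R T -> p y0 = h t0 ->
  exists2 f : T -> Y, continuous f & forall t, p (f t) = h t.
Proof.
move=> pcov ch [_ Tpc Tsc] Tlpc y0E.
pose W := [set w : T * Y | p w.2 = h w.1].
have fst_continuous (g : R -> T * Y) : continuous g -> continuous (fst \o g).
  by move=> cg s; apply: (@continuous_comp _ _ _ g fst);
    [exact: cg|exact: cvg_fst].
have snd_continuous (g : R -> T * Y) : continuous g -> continuous (snd \o g).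
  by move=> cg s; apply: (@continuous_comp _ _ _ g snd);
    [exact: cg|exact: cvg_snd].
(* Existence of a value at [t]: lift the image of a path from [t0] to [t]. *)
have total t : exists y, joined R W (t0, y0) (t, y).
  have [g cg [g0 g1]] := Tpc t0 t.
  have cgc : continuous (g \o clampI).
    by move=> s; apply: continuous_comp; [exact: continuous_clampI|exact: cg].
  have chg : continuous (h \o (g \o clampI)).
    by move=> s; apply: continuous_comp; [exact: cgc|exact: ch].
  have [|f [cf f0 pf]] := @path_lift _ _ _ p _ y0 pcov chg.
    by rewrite /= clampI0 g0.
  exists (f 1), (fun s => (g (clampI s), f (clamp s))); split.
  - apply: continuous_pair => s; first exact: cgc.
    by apply: continuous_comp; [exact: continuous_clamp|exact: cf].
  - move=> s; rewrite /W /= pf /=; congr (h (g _)); apply: val_inj => /=.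
    by rewrite !(clamp_id (clamp_itv _)).
  - by rewrite clampI0 g0 clamp_id ?lexx ?ler01// f0.
  - by rewrite clampI1 g1 clamp_id ?lexx ?ler01.
(* Uniqueness of the value: two candidates are joined by a path [g] in [W], which projects to a loop
   [k] in [T]. *)
have functional t y1 y2 : joined R W (t0, y0) (t, y1) ->
    joined R W (t0, y0) (t, y2) -> y1 = y2.
  move=> /joined_sym j1 /(joined_trans j1) [g [cg Wg g0 g1]].
  pose k : unitI R -> T := fst \o g \o set_val.
  have ck : continuous k.
    move=> s; apply: (@continuous_comp _ _ _ set_val (fst \o g)).
      exact: initial_continuous.
    exact: fst_continuous.
  have k0 : k I0 = t by rewrite /k /= g0.
  have k1 : k I1 = t by rewrite /k /= g1.
  have [|H cH [H0 H1 Hl Hr]] := Tsc k ck; first by rewrite k0 k1.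
  rewrite k0 in H1 Hl Hr.
  pose hH (w : R * R) := h (H (clampI w.1, clampI w.2)).
  have chH : continuous hH.
    move=> w; apply: (@continuous_comp _ _ _
      (fun w : R * R => H (clampI w.1, clampI w.2)) h); last exact: ch.
    apply: (@continuous_comp _ _ _
      (fun w : R * R => (clampI w.1, clampI w.2)) H); last exact: cH.
    apply: continuous_pair => {}w.
      by apply: (@continuous_comp _ _ _ fst clampI);
        [exact: cvg_fst|exact: continuous_clampI].
    by apply: (@continuous_comp _ _ _ snd clampI);
      [exact: cvg_snd|exact: continuous_clampI].
  have py1 : p y1 = h t by have := Wg 0; rewrite g0.
  have [|M [cM M0 pM]] := @square_lift _ _ _ p hH y1 pcov chH.
    by rewrite /hH /= clampI0 H0 k0.
  have clc (s : R) : clampI (clamp s) = clampI s.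
    by apply: val_inj; rewrite /= clamp_id// clamp_itv.
  (* Lifts of a constant path are constant. *)
  have const (m : R -> Y) a : continuous m -> 0 <= a <= 1 ->
      (forall s, p (m s) = h t) -> m a = y1 ->
      forall s, 0 <= s <= 1 -> m s = y1.
    move=> cm a01 pm ma s s01.
    apply: (@lift_unique Y X R p `[0, 1]%classic m (fun=> y1) a) => //.
    - exact: segment_connected.
    - exact: continuous_subspaceT.
    - by apply: continuous_subspaceT => z; exact: cvg_cst.
    - by move=> z _; rewrite pm py1.
  have i0 : 0 <= (0 : R) <= 1 by rewrite lexx ler01.
  have i1 : 0 <= (1 : R) <= 1 by rewrite lexx ler01.
  have cMl (s : R) : continuous (fun u => M (s, u)).
    by move=> u; apply: (@continuous_comp _ _ _ (pair s) M);
      [exact: continuous_pairl|exact: cM].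
  have cMr (s : R) : continuous (fun u => M (u, s)).
    by move=> u; apply: (@continuous_comp _ _ _ (fun u => (u, s)) M);
      [exact: continuous_pairr|exact: cM].
  (* The homotopy is constant on three sides of the square; following their lifts from (0, 0)
     through (0, 1) and (1, 1) gives the value [y1] at (1, 0). *)
  have M01 : M (0, 1) = y1.
    apply: (const (fun u => M (0, u)) 0) => // s.
    by rewrite pM /hH /= !clc clampI0 Hl.
  have M11 : M (1, 1) = y1.
    apply: (const (fun u => M (u, 1)) 0) => // s.
    by rewrite pM /hH /= !clc clampI1 H1.
  have M10 : M (1, 0) = y1.
    apply: (const (fun u => M (1, u)) 1) => // s.
    by rewrite pM /hH /= !clc clampI1 Hr.
  (* The fourth side of the lifted square and the second component of [g] lift the same path from
     [y1], so they have the same end. *)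
  have -> : y2 = (g 1).2 by rewrite g1.
  rewrite -M10.
  apply: (@lift_unique Y X R p `[0, 1]%classic
    (fun u => M (u, 0)) (snd \o g) 0) => //.
  - exact: segment_connected.
  - exact: continuous_subspaceT.
  - by apply: continuous_subspaceT; exact: snd_continuous.
  - move=> s; rewrite /= in_itv => s01; rewrite pM /hH /= !clc clampI0 H0.
    by rewrite /k /= set_valE /= clamp_id// -Wg.
  - by rewrite M0 /= g0.
have [f fP] := choice total.
have pf t : p (f t) = h t.
  by have [g [_ Wg _ g1]] := fP t; have := Wg 1; rewrite g1.
exists f => // t.
have [U [oU Ut] Us] := covering_sheets (h t) pcov.
have [|V [s [oV Vt sp ps cs]]] := Us (f t); first by rewrite pf.
have sft : s (h t) = f t by rewrite -pf sp.
have ohU : open (h @^-1` U) by move/continuousP: ch; exact.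
have Nt : nbhs t (joined R (h @^-1` U) t).
  by apply: open_nbhs_nbhs; split; [exact: Tlpc|exact: joined_refl].
(* On the path component of [t] in the preimage of [U], which is open, [f] is the local lift
   [s \o h]; this gives continuity at [t]. *)
have loc t' : joined R (h @^-1` U) t t' -> f t' = s (h t').
  move=> [g [cg Ug g0 g1]]; apply: (functional t') => //.
  apply: joined_trans (fP t) _; exists (fun u => (g u, s (h (g u)))); split.
  - apply: continuous_pair => // u.
    apply: (@continuous_comp _ _ _ (h \o g) s);
      last by apply: cs; exact: Ug.
    by apply: continuous_comp; [exact: cg|exact: ch].
  - by move=> u; rewrite /W /= ps//; exact: Ug.
  - by rewrite g0 sft.
  - by rewrite g1.
have : {for t, continuous (s \o h)}.
  by apply: continuous_comp; [exact: ch|exact: cs].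
rewrite /prop_for /continuous_at /= sft => csh A /csh; rewrite !nbhs_simpl /=.
move=> shA; apply: filterS2 Nt shA => t' jt' /=.
by rewrite loc.
Qed.

(** * Finitely supported measures *)

(** Two initial topologies are unfolded: the one along [fprob_eval], and the pointwise one on its
    target. *)
Lemma fprob_continuousP (R : realType) (Z T : topologicalType) (n : nat)
    (s : T -> fprob R Z n) :
  continuous s <-> forall g : Z -> R, @test_functions R Z g ->
    continuous (fun t => fintegral (val (s t : fprob_set n)) g : R).
Proof.
split => [cs g tg|H].
  pose G : @test_functions R Z := exist _ g (mem_set tg).
  have cG : continuous (fun mu : fprob R Z n => fprob_eval mu G).
    move=> mu; apply: (@continuous_comp (fprob R Z n)
      {ptws @test_functions R Z -> R} R (@fprob_eval R Z n) (fun e => e G)).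
      exact: initial_continuous.
    exact: (@proj_continuous (@test_functions R Z) (fun=> R) G).
  move=> t; apply: (@continuous_comp T (fprob R Z n) R s
    (fun mu => fprob_eval mu G)); [exact: cs|exact: cG].
apply: continuous_into_initial => t; apply/cvg_sup => g.
apply: (continuous_into_initial (f := fun f : @test_functions R Z -> R => f g)).
exact: H (set_valP g).
Qed.

Lemma fintegral_supset (R : realType) (Z : topologicalType)
    (mu : {fsfun Z -> R with 0}) (g : Z -> R) (A : {fset Z}) :
  (finsupp mu `<=` A)%fset -> fintegral mu g = \sum_(z <- A) mu z * g z.
Proof.
move=> sA; rewrite /fintegral; apply: big_fset_incl => // z _ /fsfun_dflt ->.
by rewrite mul0r.
Qed.

(** The average of the measures [k z] with weights [mu z]. The finite set bounding its support is
    the union of the supports of the [k z], outside which the sum vanishes anyway. *)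
Definition fbind (R : realType) (Z W : topologicalType)
    (mu : {fsfun Z -> R with 0}) (k : Z -> {fsfun W -> R with 0}) :
    {fsfun W -> R with 0} :=
  [fsfun w in (\bigcup_(z <- finsupp mu) finsupp (k z))%fset =>
     \sum_(z <- finsupp mu) mu z * k z w].

Lemma fbindE (R : realType) (Z W : topologicalType)
    (mu : {fsfun Z -> R with 0}) (k : Z -> {fsfun W -> R with 0}) w :
  fbind mu k w = \sum_(z <- finsupp mu) mu z * k z w.
Proof.
rewrite fsfunE; case: ifPn => // wk.
rewrite big_seq big1// => z zmu; rewrite (@fsfun_dflt _ _ _ (k z)) ?mulr0//.
by apply: contra wk => wk; apply/bigfcupP; exists z; rewrite ?zmu.
Qed.

Lemma finsupp_fbind (R : realType) (Z W : topologicalType)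
    (mu : {fsfun Z -> R with 0}) (k : Z -> {fsfun W -> R with 0}) :
  (finsupp (fbind mu k) `<=` \bigcup_(z <- finsupp mu) finsupp (k z))%fset.
Proof. exact: finsupp_sub. Qed.

(** Fubini for finite sums, once the inner sums are extended to the union of the supports. *)
Lemma fintegral_fbind (R : realType) (Z W : topologicalType)
    (mu : {fsfun Z -> R with 0}) (k : Z -> {fsfun W -> R with 0})
    (g : W -> R) :
  fintegral (fbind mu k) g = fintegral mu (fun z => fintegral (k z) g).
Proof.
rewrite (fintegral_supset _ (finsupp_fbind _ _)).
transitivity (\sum_(w <- (\bigcup_(z <- finsupp mu) finsupp (k z))%fset)
    \sum_(z <- finsupp mu) mu z * k z w * g w).
  by apply: eq_bigr => w _; rewrite fbindE mulr_suml.
rewrite exchange_big /= /fintegral big_seq [RHS]big_seq.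
apply: eq_bigr => z zmu.
have sk : (finsupp (k z) `<=` \bigcup_(z <- finsupp mu) finsupp (k z))%fset.
  exact: bigfcup_sup.
rewrite -/(fintegral (k z) g) (fintegral_supset _ sk) mulr_sumr.
by apply: eq_bigr => w _; rewrite mulrA.
Qed.

Lemma card_bigfcup (I K : choiceType) (r : seq I) (F : I -> {fset K}) (m : nat) :
  (forall i, #|` F i| <= m)%N ->
  (#|` (\bigcup_(i <- r) F i)%fset| <= size r * m)%N.
Proof.
move=> Fm; elim: r => [|i r IH]; first by rewrite big_nil cardfs0.
rewrite big_cons mulSn cardfsU; apply: leq_trans (leq_subr _ _) _.
exact: leq_add.
Qed.

Lemma fbind_fprob (R : realType) (Z W : topologicalType) (n m k : nat)
    (mu : {fsfun Z -> R with 0}) (K : Z -> {fsfun W -> R with 0}) :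
  (n * m <= k)%N -> fprob_set n mu -> (forall z, fprob_set m (K z)) ->
  fprob_set k (fbind mu K).
Proof.
move=> nmk [mu0 mu1 mun] HK; split.
- move=> w; rewrite fbindE; apply: sumr_ge0 => z _; apply: mulr_ge0 => //.
  by have [] := HK z.
(* The total mass is the integral of 1, so it is computed by [fintegral_fbind]. *)
- have -> : \sum_(w <- finsupp (fbind mu K)) fbind mu K w =
      fintegral (fbind mu K) (fun=> 1).
    by apply: eq_bigr => w _; rewrite mulr1.
  rewrite fintegral_fbind; transitivity (\sum_(z <- finsupp mu) mu z) => //.
  apply: eq_bigr => z _; have [_ Kz1 _] := HK z.
  rewrite -[RHS]mulr1 -[in RHS]Kz1; congr (_ * _).
  by apply: eq_bigr => w _; rewrite mulr1.
- apply: leq_trans (fsubset_leq_card (finsupp_fbind _ _)) _.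
  apply: leq_trans nmk; apply: leq_trans (card_bigfcup _ (m := m) _) _.
    by move=> z; have [] := HK z.
  by rewrite leq_mul2r mun orbT.
Qed.

Lemma fprob_bind (R : realType) (Z W : topologicalType) (n m k : nat)
    (K : Z -> fprob R W m) : (n * m <= k)%N -> continuous K ->
  exists2 b : fprob R Z n -> fprob R W k, continuous b &
    forall mu w, fsupp (b mu) w -> exists2 z, fsupp mu z & fsupp (K z) w.
Proof.
move=> nmk /fprob_continuousP cK.
pose K' z := val (K z : fprob_set m).
have K'P z : fprob_set m (K' z) by exact: set_valP.
pose b (mu : fprob R Z n) : fprob R W k := (exist _
  (fbind (val (mu : fprob_set n)) K')
  (mem_set (fbind_fprob nmk (set_valP mu) K'P)) : fprob_set k).
exists b; last first.
  move=> mu w /= /(fsubsetP (finsupp_fbind _ _)) /bigfcupP[z].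
  by rewrite andbT => zmu wK; exists z.
apply/fprob_continuousP => g [cg [M gM]].
have H : continuous (fun mu : fprob R Z n =>
    fintegral (val (mu : fprob_set n)) (fun z => fintegral (K' z) g)).
  (* For the identity map, the criterion says that integrating a test function is continuous on
     [fprob R Z n]. *)
  have /fprob_continuousP : continuous (id : fprob R Z n -> fprob R Z n).
    by move=> ?; exact: cvg_id.
  apply; split; first exact: cK g (conj cg (ex_intro _ M gM)).
  (* A bound for [g] also bounds its integral against a probability measure. *)
  exists M => z; have [K0 K1 _] := K'P z.
  rewrite /fintegral (le_trans (ler_norm_sum _ _ _))//.
  rewrite -[M]mul1r -K1 mulr_suml; apply: ler_sum => w _.
  by rewrite normrM ger0_norm// ler_wpM2l.
move=> mu.
rewrite (_ : (fun _ => _) = fun mu : fprob R Z n =>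
    fintegral (val (mu : fprob_set n)) (fun z => fintegral (K' z) g)); first exact: H.
by apply/funext => nu; rewrite /= fintegral_fbind.
Qed.

Definition fdirac (R : realType) (Z : topologicalType) (z : Z) :
  {fsfun Z -> R with 0} := [fsfun z' in [fset z]%fset => 1].

Lemma finsupp_fdirac (R : realType) (Z : topologicalType) (z : Z) :
  finsupp (fdirac R z) = [fset z]%fset.
Proof.
apply/fsetP => w; rewrite mem_finsupp fsfunE.
by case: ifPn; rewrite ?oner_eq0 ?eqxx.
Qed.

Lemma fdirac1 (R : realType) (Z : topologicalType) (z : Z) : fdirac R z z = 1.
Proof. by rewrite fsfunE inE eqxx. Qed.

(** Averaging this kernel [d] pushes measures forward along [f]. *)
Lemma fprob_dirac (R : realType) (Z W : topologicalType) (f : Z -> W) :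
  continuous f -> exists2 d : Z -> fprob R W 1, continuous d &
    forall z, fsupp (d z) = [set f z].
Proof.
move=> cf.
have dP (w : W) : fprob_set 1 (fdirac R w).
  split.
  - by move=> z; rewrite fsfunE; case: ifP.
  - by rewrite finsupp_fdirac big_seq_fset1 fdirac1.
  - by rewrite finsupp_fdirac cardfs1.
pose d z : fprob R W 1 := (exist _ (fdirac R (f z)) (mem_set (dP (f z))) :
  fprob_set 1).
exists d; last first.
  move=> z; rewrite /fsupp /= finsupp_fdirac.
  by apply/seteqP; split => w /=; rewrite inE => /eqP.
apply/fprob_continuousP => g [cg _] z.
rewrite (_ : (fun _ => _) = g \o f); first by apply: continuous_comp;
  [exact: cf|exact: cg].
apply/funext => z' /=.
by rewrite /fintegral finsupp_fdirac big_seq_fset1 fdirac1 mul1r.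
Qed.

(** * Sections *)

(** Only the first half of the concatenated path depends on [phi], and doubling the parameter
    carries the part of a compact set in that half to a compact set. This gives continuity in the
    compact-open topology. *)
Lemma path_pushforward (R : realType) (X Y : topologicalType) (p : Y -> X)
    (x0 : X) (y0 : Y) : continuous p -> joined R setT (p y0) x0 ->
  exists2 F : based_paths R y0 -> based_paths R x0, continuous F &
    forall phi, path_start (F phi) = p (path_start phi).
Proof.
move=> cp [eta [ceta _ eta0 eta1]].
pose F0 (phi : unitI R -> Y) : unitI R -> X :=
  path_cat (p \o phi \o clampI) eta \o set_val.
have F0P (phi : unitI R -> Y) : based_paths R y0 phi ->
    based_paths R x0 (F0 phi).
  move=> [cphi phi1]; split; last by rewrite /F0 /= set_valE /= path_cat1.
  move=> t; apply: (@continuous_comp _ _ _ set_val _ t).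
    exact: initial_continuous.
  apply: continuous_path_cat => //; last by rewrite /= clampI1 phi1 eta0.
  move=> s; apply: (@continuous_comp _ _ _ clampI (p \o phi)).
    exact: continuous_clampI.
  by apply: continuous_comp; [exact: cphi|exact: cp].
pose F (phi : based_paths R y0) : based_paths R x0 :=
  exist _ (F0 (set_val phi)) (mem_set (F0P _ (set_valP phi))).
have FE (phi : based_paths R y0) : set_val (F phi) = F0 (set_val phi) by [].
exists F; last first.
  move=> phi; rewrite /path_start FE /F0 /= set_valE /= path_cat0 /=.
  by rewrite clampI0.
apply: (continuous_into_initial
  (f := set_val : based_paths R x0 -> {compact-open, unitI R -> X})).
move=> phi.
have FF : Filter ((set_val \o F) @ phi) by apply: fmap_filter; exact: nbhs_filter.
apply/compact_open_cvgP => K B cK oB KB.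
pose L := [set t : unitI R | set_val t <= 2^-1].
have cL : closed L.
  have -> : L = (set_val : unitI R -> R) @^-1` [set t | t <= 2^-1] by [].
  have cv : continuous (set_val : unitI R -> R) by exact: initial_continuous.
  by move/continuous_closedP: cv; apply; exact: closed_le.
pose dbl (t : unitI R) : unitI R := clampI (2 * set_val t).
have cdbl : continuous dbl.
  have c2 : continuous (fun r : R => 2 * r).
    by move=> r; apply: cvgM; [exact: cvg_cst|exact: cvg_id].
  move=> t.
  apply: (@continuous_comp _ R _ set_val (fun r => clampI (2 * r))).
    exact: initial_continuous.
  apply: (@continuous_comp R R _ (fun r => 2 * r) clampI); first exact: c2.
  exact: continuous_clampI.
have cK1 : compact (dbl @` (K `&` L)).
  apply: continuous_compact; first exact: continuous_subspaceT.
  exact: compact_closedI.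
have oU : open (p @^-1` B) by move/continuousP: cp; exact.
have oN := compact_open_open cK1 oU.
have F0l (f : unitI R -> Y) t : L t -> F0 f t = p (f (dbl t)).
  by move=> Lt; rewrite /F0 /= path_cat_left.
have F0r (f : unitI R -> Y) t : ~ L t -> F0 f t = eta (2 * set_val t - 1).
  by move=> /negP/negPf Lt; rewrite /F0 /path_cat /= Lt.
have Nphi : nbhs phi [set phi' : based_paths R y0 |
    (set_val phi' : unitI R -> Y) @` (dbl @` (K `&` L)) `<=` p @^-1` B].
  have cv : continuous (set_val : based_paths R y0 ->
      {compact-open, unitI R -> Y}) by exact: initial_continuous.
  apply: (cv phi [set f : {compact-open, unitI R -> Y} |
    f @` (dbl @` (K `&` L)) `<=` p @^-1` B]).
  apply: open_nbhs_nbhs; split; first exact: oN.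
  move=> _ [_ [t [Kt Lt] <-] <-] /=; rewrite -F0l//.
  by apply: KB; exists t.
apply: filterS Nphi => phi' H _ [t Kt <-] /=.
(* In the first half the neighbourhood of [phi] controls the value; in the second both
   concatenations follow [eta]. *)
have [Lt|Lt] := pselect (L t).
  rewrite FE F0l//; apply: H; exists (dbl t) => //.
  by exists t.
rewrite FE F0r// -(F0r (set_val phi))//.
by apply: KB; exists t.
Qed.

Lemma fsupp_nonempty (R : realType) (Z : topologicalType) (n : nat)
    (mu : fprob R Z n) : fsupp mu !=set0.
Proof.
have [_ mu1 _] := set_valP mu.
apply/set0P/negP => /eqP mu0; move: mu1.
rewrite big_seq big1 ?eqxx//; first by move/eqP; rewrite eq_sym oner_eq0.
by move=> z zmu; have : fsupp mu z by []; rewrite mu0.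
Qed.

(** Supports are nonempty, so the base point chosen by [fibrewise_map] is the only possible one.
    This removes the subtype from later arguments. *)
Lemma has_section_fibrewiseP (R : realType) (E B : topologicalType)
    (f : E -> B) (n : nat) :
  has_section (fibrewise_map R f n) <->
  exists2 s : B -> fprob R E n, continuous s &
    forall b, fsupp (s b) `<=` f @^-1` [set b].
Proof.
split => [[s cs sK]|[s cs sf]].
  exists (fun b => set_val (s b)).
    move=> b; apply: (@continuous_comp _ _ _ s set_val); first exact: cs.
    exact: initial_continuous.
  by move=> b; rewrite -{2}(sK b); exact: (svalP (cid (set_mem (valP (s b))))).
have sF b : s b \in @fibrewise_fprob R E B f n by apply/mem_set; exists b.
exists (fun b => exist _ (s b) (sF b)).
  exact: (continuous_into_initial (f := set_val)).
move=> b; rewrite /fibrewise_map; case: cid => /= b' sb'.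
by have [e se] := fsupp_nonempty (s b); rewrite -(sb' e se) -(sf b e se).
Qed.

Lemma fibrewise_section_cover (R : realType) (X Y Xt : topologicalType)
    (x0 : X) (y0 : Y) (p : Y -> X) (q : Xt -> X) (n m : nat) :
  CW_complex R X -> covering_map p -> universal_covering R q ->
  has_section (fibrewise_map R q n) ->
  has_section (fibrewise_map R (@path_start R Y y0) m) ->
  has_section (fibrewise_map R (@path_start R X x0) (n * m)).
Proof.
move=> CWX pcov [qcov Xtsc] /has_section_fibrewiseP[s cs sq].
move=> /has_section_fibrewiseP[sY csY sYs]; apply/has_section_fibrewiseP.
have qsurj x : exists z, q z = x.
  by have [z sz] := fsupp_nonempty (s x); exists z; exact: (sq x z sz).
have [z0 z0E] := qsurj (p y0).
have [z1 z1E] := qsurj x0.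
have [cq _] := qcov; have [cp _] := pcov; have [_ Xtpc _] := Xtsc.
have px : joined R setT (p y0) x0.
  have [g cg [g0 g1]] := Xtpc z0 z1.
  exists (q \o g \o clampI); split => //.
  - move=> t; apply: (@continuous_comp _ _ _ clampI (q \o g)).
      exact: continuous_clampI.
    by apply: continuous_comp; [exact: cg|exact: cq].
  - by rewrite /= clampI0 g0.
  - by rewrite /= clampI1 g1.
have [F cF FE] := path_pushforward cp px.
have Xtlpc := covering_locally_path_connected qcov
  (CW_locally_path_connected CWX).
have [f cf pf] := simply_connected_lift pcov cq Xtsc Xtlpc (esym z0E).
have [d cd dE] := fprob_dirac R cF.
(* The pushforward along [F] averages Dirac measures, so the bound [m] on the number of atoms is
   kept. *)
have m1 : (m * 1 <= m)%N by rewrite muln1.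
have [b1 cb1 b1E] := fprob_bind m1 cd.
have cK : continuous (b1 \o (sY \o f)).
  move=> z; apply: (@continuous_comp _ _ _ (sY \o f) b1); last exact: cb1.
  by apply: continuous_comp; [exact: cf|exact: csY].
have [b2 cb2 b2E] := fprob_bind (leqnn (n * m)) cK.
exists (b2 \o s).
  by move=> x; apply: continuous_comp; [exact: cs|exact: cb2].
(* An atom [w] over [x] comes from an atom [z] of [s x] and a path [phi] starting at [f z]; then [w]
   is [F phi], which starts at [p (f z)], that is [q z], that is [x]. *)
move=> x w /b2E[z /sq /= zx /b1E[phi /sYs /= phiz]].
by rewrite dE => ->; rewrite FE phiz pf.
Qed.

(** A nonempty set of natural numbers attains its infimum. *)
Lemma least_section_cases (R : realType) (E B : topologicalType) (f : E -> B) :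
  least_section R f = +oo%E \/
  exists2 n, has_section (fibrewise_map R f n.+1) &
    least_section R f = (n%:R)%:E.
Proof.
have [[n0 sn0]|nosec] :=
  pselect (exists n, has_section (fibrewise_map R f n.+1)); last first.
  left; rewrite /least_section.
  rewrite (_ : [set n : nat | _] = set0) ?image_set0 ?ereal_inf0//.
  by apply/seteqP; split => n //= sn; apply: nosec; exists n.
have ex : exists n, `[< has_section (fibrewise_map R f n.+1) >].
  by exists n0; apply/asboolP.
right; case: (ex_minnP ex) => n /asboolP sn minn; exists n => //.
apply/eqP; rewrite eq_le; apply/andP; split.
  by apply: ereal_inf_lbound; exists n.
apply/ereal_infP => _ [k sk <-]; rewrite lee_fin ler_nat.
by apply: minn; apply/asboolP.
Qed.

Unset Implicit Arguments.

Theorem theorem8p1 (R : realType) (X Y : topologicalType) (x0 : X) (y0 : Y)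
  (p : Y -> X) (Xt : topologicalType) (q : Xt -> X) :
  CW_complex R X -> connected [set: X] ->
  CW_complex R Y -> connected [set: Y] ->
  covering_map p ->
  universal_covering R q ->
  (dcat R x0 <= (dcat1 R q + 1) * (dcat R y0 + 1) - 1)%E.
Proof.
move=> CWX _ _ _ pcov qcov; rewrite /dcat /dcat1.
case: (least_section_cases R (@path_start R Y y0)) => [->|[m sm ->]];
  case: (least_section_cases R q) => [->|[n sn ->]].
(* If one invariant is infinite, the other factor is positive, so the right-hand side is [+oo]. *)
- by rewrite addye// leey.
- by rewrite addye// gt0_muley ?addye ?leey// -EFinD lte_fin ltr_wpDl// ler0n.
- by rewrite addye// gt0_mulye ?addye ?leey// -EFinD lte_fin ltr_wpDl// ler0n.
have := fibrewise_section_cover x0 CWX pcov qcov sn sm.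
(* The atom count (n + 1) (m + 1) is the successor of m + n (m + 1), which is the index bounding
   [dcat]. *)
rewrite mulSn addSn => s.
apply: ereal_inf_lbound; exists (m + n * m.+1)%N => //.
transitivity ((n%:R + 1) * (m%:R + 1) - 1 : R)%:E => //.
by congr EFin; rewrite natrD natrM -natr1; ring.
Qed.
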